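(* Let $p\geq 2$ and $j$ be integers, and let $x$ denote a square root of $j+2$ (in $\mathbb{C}$). Then for all integers $k$ (for which the denominators below are nonzero) $$ s_k(\mathcal{T}_p(j)) = R_k(j)\, s_k(j), \qquad R_k(j)=\frac{\mathcal{U}_{p-1}\big(\mathcal{T}_{2k+1}(x)\big)}{\mathcal{U}_{p-1}(x)}\in\mathbb{Q}, $$ and the sequence $(R_k(j))_{k}$ satisfies a linear recurrence of order $p$ with constant coefficients. In particular, for $p=2$ one has $R_k(j)=r_k(j)\in\mathbb{Z}$, while for every odd $p$ $$ R_k(j)=\frac{s_{(p-1)/2}\big(\mathcal{T}_{2k+1}(j)\big)}{s_{(p-1)/2}(j)}\in\mathbb{Q} $$ and $$ (\mathrm{S}-1)\prod_{i=1}^{(p-1)/2}\big(\mathrm{S}^2-\mathcal{T}_{2i}(j)\,\mathrm{S}+1\big)\, R_k(j)=0, $$ where $\mathrm{S}$ is the forward shift $\mathrm{S}\,f_k=f_{k+1}$ in the index $k$.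
   Context: For a number $n$, the sequence $(s_k(n))_{k\in\mathbb{Z}}$ is defined by $s_0(n)=1$, $s_1(n)=n+1$, $s_{k+2}(n)=n\,s_{k+1}(n)-s_k(n)$ for all $k\in\mathbb{Z}$, and $(r_k(n))_{k\in\mathbb{Z}}$ by $r_0(n)=1$, $r_1(n)=n-1$, $r_{k+2}(n)=n\,r_{k+1}(n)-r_k(n)$. The dilated Chebyshev polynomials $\mathcal{T}_k,\mathcal{U}_k$ ($k\in\mathbb{Z}$) are defined by $\mathcal{T}_k(2\cos\theta)=2\cos(k\theta)$ and $\mathcal{U}_k(2\cos\theta)=\sin((k+1)\theta)/\sin\theta$; equivalently both satisfy $y_{k+2}=x\,y_{k+1}-y_k$ with $\mathcal{T}_0=2,\mathcal{T}_1(x)=x$ and $\mathcal{U}_0=1,\mathcal{U}_1(x)=x$. *)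

(* Defs.v *)
From mathcomp Require Import all_boot all_order all_algebra.
From mathcomp Require Import reals trigo.
From mathcomp Require Import ring zify.

Set Implicit Arguments.
Unset Strict Implicit.
Unset Printing Implicit Defensive.

Import Order.TTheory GRing.Theory Num.Theory.
Local Open Scope ring_scope.

Section TwoSided.
Variable A : comNzRingType.
Implicit Types (n a b : A) (k : int).

Fixpoint recn n a b (m : nat) : A :=
  if m is m'.+1 then recn n b (n * b - a) m' else a.

(* The two-sided solution of y_(k+2) = n y_(k+1) - y_k with y_0 = a and
   y_1 = b.  The recurrence is invariant under k |-> -k, and
   y_(-1) = n a - b. *)
Definition recz n a b k : A :=
  match k with
  | Posz m => recn n a b m
  | Negz m => recn n a (n * a - b) m.+1
  end.

Lemma recnSS n a b m :
  recn n a b m.+2 = n * recn n a b m.+1 - recn n a b m.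
Proof. by elim: m a b => [//|m IHm] a b; exact: IHm. Qed.

Lemma recz0 n a b : recz n a b 0 = a. Proof. by []. Qed.

Lemma recz1 n a b : recz n a b 1 = b. Proof. by []. Qed.

Lemma reczSS n a b k :
  recz n a b (k + 2) = n * recz n a b (k + 1) - recz n a b k.
Proof.
case: k => m.
  by rewrite -!PoszD addn2 addn1 /recz recnSS.
case: m => [|[|m]].
- by rewrite /= ; ring.
- by rewrite /= ; ring.
have -> : Negz m.+2 + 2 = Negz m by lia.
have -> : Negz m.+2 + 1 = Negz m.+1 by lia.
rewrite /recz [recn _ _ _ m.+3]recnSS; ring.
Qed.

Definition sseq k n : A := recz n 1 (n + 1) k.

Definition rseq k n : A := recz n 1 (n - 1) k.

End TwoSided.

Definition chebT (A : comNzRingType) (k : int) : {poly A} := recz 'X 2%:R 'X k.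

Definition chebU (A : comNzRingType) (k : int) : {poly A} := recz 'X 1 'X k.

Arguments chebT {A} k.
Arguments chebU {A} k.

Lemma int_ind2 (P : int -> Prop) : P 0 -> P 1 ->
  (forall k, P k -> P (k + 1) -> P (k + 2)) ->
  (forall k, P (k + 1) -> P (k + 2) -> P k) -> forall k, P k.
Proof.
move=> P0 P1 Pup Pdown.
have pos (m : nat) : P m /\ P (m%:Z + 1).
  elim: m => [//|m [Pm Pm1]].
  have -> : m.+1%:Z = m%:Z + 1 by lia.
  by split=> //; rewrite -addrA; exact: Pup.
have neg (m : nat) : P (- m%:Z) /\ P (- m%:Z + 1).
  elim: m => [//|m [Pm Pm1]].
  have e1 : - m.+1%:Z + 1 = - m%:Z by lia.
  have e2 : - m.+1%:Z + 2 = - m%:Z + 1 by lia.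
  by split; [apply: Pdown; rewrite ?e1 ?e2 | rewrite e1].
by case=> m; [case: (pos m) | rewrite NegzE; case: (neg m.+1)].
Qed.

Lemma chebT_cos (R : realType) (k : int) (t : R) :
  (chebT k).[2 * cos t] = 2 * cos (k%:~R * t).
Proof.
have E l : (chebT (l + 2)).[2 * cos t] =
    2 * cos t * (chebT (l + 1)).[2 * cos t] - (chebT l).[2 * cos t].
  by rewrite /chebT reczSS !hornerE.
have C (l : int) : cos ((l + 2)%:~R * t) =
    2 * cos t * cos ((l + 1)%:~R * t) - cos (l%:~R * t) :> R.
  have -> : (l + 2)%:~R * t = (l + 1)%:~R * t + t by rewrite !intrD; ring.
  have -> : l%:~R * t = (l + 1)%:~R * t - t by rewrite !intrD; ring.
  by rewrite cosD cosB; ring.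
elim/int_ind2: k => [||l H H1|l H1 H2].
- by rewrite /chebT recz0 mul0r cos0 -polyC_natr hornerC mulr1.
- by rewrite /chebT recz1 hornerX mul1r.
- by rewrite E H H1 C; ring.
- have -> : cos (l%:~R * t) =
      2 * cos t * cos ((l + 1)%:~R * t) - cos ((l + 2)%:~R * t).
    by rewrite C subKr.
  have -> : (chebT l).[2 * cos t] = 2 * cos t * (chebT (l + 1)).[2 * cos t] -
      (chebT (l + 2)).[2 * cos t] by rewrite E subKr.
  by rewrite H1 H2; ring.
Qed.

Lemma chebU_sin (R : realType) (k : int) (t : R) :
  (chebU k).[2 * cos t] * sin t = sin ((k + 1)%:~R * t).
Proof.
have E l : (chebU (l + 2)).[2 * cos t] =
    2 * cos t * (chebU (l + 1)).[2 * cos t] - (chebU l).[2 * cos t].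
  by rewrite /chebU reczSS !hornerE.
have C (l : int) : sin ((l + 2 + 1)%:~R * t) =
    2 * cos t * sin ((l + 1 + 1)%:~R * t) - sin ((l + 1)%:~R * t) :> R.
  have -> : (l + 2 + 1)%:~R * t = (l + 1 + 1)%:~R * t + t
    by rewrite !intrD; ring.
  have -> : (l + 1)%:~R * t = (l + 1 + 1)%:~R * t - t by rewrite !intrD; ring.
  by rewrite sinD sinB; ring.
elim/int_ind2: k => [||l H H1|l H1 H2].
- by rewrite /chebU recz0 hornerC mul1r add0r mul1r.
- rewrite /chebU recz1 hornerX.
  have -> : (1 + 1)%:~R * t = t + t by rewrite intrD; ring.
  by rewrite sinD; ring.
- by rewrite E C -H -H1; ring.
- have -> : sin ((l + 1)%:~R * t) =
      2 * cos t * sin ((l + 1 + 1)%:~R * t) - sin ((l + 2 + 1)%:~R * t).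
    by rewrite C subKr.
  have -> : (chebU l).[2 * cos t] = 2 * cos t * (chebU (l + 1)).[2 * cos t] -
      (chebU (l + 2)).[2 * cos t] by rewrite E subKr.
  by rewrite -H1 -H2; ring.
Qed.

(* R_k, in terms of the chosen square root x of j + 2. *)
Definition Rquot (F : fieldType) (p : nat) (x : F) (k : int) : F :=
  (chebU (p%:Z - 1)).[(chebT (2 * k + 1)).[x]] / (chebU (p%:Z - 1)).[x].

Section Shift.
Variable F : fieldType.

Definition shift (f : int -> F) : int -> F := fun k => f (k + 1).

(* The sequence P(S) f, where S is the forward shift. *)
Definition shift_poly (P : {poly F}) (f : int -> F) : int -> F :=
  fun k => \sum_(i < size P) P`_i * iter i shift f k.

(* The characteristic polynomial P is rational; P`_0 != 0 says that the
   order is exactly p. *)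
Definition rat_linear_recurrence (p : nat) (f : int -> F) : Prop :=
  exists2 P : {poly rat}, [/\ P \is monic, size P = p.+1 & P`_0 != 0]
    & forall k, shift_poly (map_poly ratr P) f k = 0.

End Shift.

(* Main.v *)
(* Every solution y of y_(k+2) = x y_(k+1) - y_k satisfies
   y_(k+l) + y_(k-l) = T_l(x) y_k; sampling along arithmetic progressions then
   gives T_(kl) = T_k(T_l), U_(kl-1) = U_(l-1) U_(k-1)(T_l),
   s_k(x^2 - 2) = U_(2k)(x) and x r_k(x^2 - 2) = T_(2k+1)(x).  With j = x^2 - 2,
   both sides of the first claim times U_(p-1)(x) equal U_(p(2k+1)-1)(x).  The
   recurrence comes from U_(p-1) = [p odd] + T_(p-1) + T_(p-3) + ..., since
   k |-> T_a(T_(2k+1)(x)) = T_((2k+1)a)(x) is killed by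
   S^2 - T_(2a)(x) S + 1 and T_(2a)(x) = T_a(j). *)
Require Import Defs.
From mathcomp Require Import all_boot all_order all_algebra.
From mathcomp Require Import reals complex.
From mathcomp Require Import ring zify.

Set Implicit Arguments.
Unset Strict Implicit.
Unset Printing Implicit Defensive.

Import Order.TTheory GRing.Theory Num.Theory.
Local Open Scope ring_scope.

(** * Two-sided solutions of the recurrence and Chebyshev identities *)

Section Recurrence.
Variable A : comNzRingType.
Implicit Types (n a b x : A) (k l m : int).

(** The recurrence can also be solved for its lowest term, so two consecutive values determine a
    solution in both directions. Most identities below reduce to comparing two starting values. *)
Lemma recz_unique n (f : int -> A) :
  (forall k, f (k + 2) = n * f (k + 1) - f k) ->
  forall k, f k = recz n (f 0) (f 1) k.
Proof.
move=> Hf; elim/int_ind2 => [||k IH IH1|k IH1 IH2] //.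
  by rewrite Hf reczSS IH IH1.
have -> : f k = n * f (k + 1) - f (k + 2) by rewrite Hf subKr.
by rewrite IH1 IH2 reczSS subKr.
Qed.

Lemma recz_eq n (f : int -> A) a b :
  (forall k, f (k + 2) = n * f (k + 1) - f k) -> f 0 = a -> f 1 = b ->
  forall k, f k = recz n a b k.
Proof. by move=> Hf <- <-; exact: recz_unique. Qed.

Lemma reczN1 n a b : recz n a b (-1) = n * a - b.
Proof. by []. Qed.

Lemma mulr_recz n a b c k : c * recz n a b k = recz n (c * a) (c * b) k.
Proof.
by apply: (recz_eq (f := fun k => c * recz n a b k)) => // l;
  rewrite reczSS; ring.
Qed.

(** For fixed [k] both sides solve the recurrence in [l], with starting values 2 y_k and x y_k at
    [l] = 0 and 1. *)
Lemma recz_addsub x a b k l :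
  recz x a b (k + l) + recz x a b (k - l) = recz x 2%:R x l * recz x a b k.
Proof.
have H2 : recz x a b k * 2%:R = recz x a b (k + 0) + recz x a b (k - 0).
  by rewrite !(subr0, addr0); ring.
have H1 : recz x a b k * x = recz x a b (k + 1) + recz x a b (k - 1).
  have := reczSS x a b (k - 1); rewrite subrK.
  by rewrite (_ : k - 1 + 2 = k + 1) => [->|]; [ring | lia].
rewrite mulrC mulr_recz H1 H2; apply: (recz_unique
  (f := fun l => recz x a b (k + l) + recz x a b (k - l))) => {}l.
have E1 := reczSS x a b (k + l).
have E2 := reczSS x a b (k - l - 2).
have e1 : k - l - 2 + 2 = k - l by lia.
have e2 : k - l - 2 + 1 = k - (l + 1) by lia.
have e3 : k - (l + 2) = k - l - 2 by lia.
by move: E1 E2; rewrite e1 e2 e3 !addrA => -> ->; ring.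
Qed.

(* Sampling a solution along an arithmetic progression of step [l] gives a
   solution of the recurrence whose parameter is the value T_l(x). *)
Lemma recz_progressionSS x a b l c k :
  recz x a b ((k + 2) * l + c) =
  recz x 2%:R x l * recz x a b ((k + 1) * l + c) - recz x a b (k * l + c).
Proof.
rewrite -recz_addsub.
have -> : (k + 1) * l + c + l = (k + 2) * l + c by ring.
have -> : (k + 1) * l + c - l = k * l + c by ring.
by rewrite addrK.
Qed.

Lemma recz_progression x a b l c k :
  recz x a b (k * l + c) =
  recz (recz x 2%:R x l) (recz x a b c) (recz x a b (l + c)) k.
Proof.
apply: (recz_eq (f := fun k => recz x a b (k * l + c))) => [m||].
- exact: recz_progressionSS.
- by rewrite mul0r add0r.
- by rewrite mul1r.
Qed.

Lemma chebTM x k l :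
  recz x 2%:R x (k * l) = recz (recz x 2%:R x l) 2%:R (recz x 2%:R x l) k.
Proof. by have := recz_progression x 2%:R x l 0 k; rewrite !addr0 recz0. Qed.

Lemma chebU_pred x k : recz x 1 x (k - 1) = recz x 0 1 k.
Proof.
have := recz_progression x 1 x 1 (-1) k.
by rewrite mulr1 addrN recz1 recz0 reczN1 mulr1 subrr.
Qed.

(** The progression of step [l] through index -1 starts with U_(-1) = 0 and U_(l-1), so it is
    U_(l-1)(x) times the solution with starting values 0 and 1. *)
Lemma chebU_predM x k l :
  recz x 1 x (k * l - 1) =
  recz x 1 x (l - 1) * recz (recz x 2%:R x l) 1 (recz x 2%:R x l) (k - 1).
Proof.
rewrite recz_progression (chebU_pred _ k) mulr_recz mulr0 mulr1 reczN1 mulr1.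
by rewrite subrr.
Qed.

Lemma chebT2 x : recz x 2%:R x 2 = x ^+ 2 - 2%:R.
Proof. by rewrite /=; ring. Qed.

(** Progression of step 2 from index 0: its parameter is T_2(x) = x^2 - 2, and it starts with 1 and
    U_2(x) = (x^2 - 2) + 1. *)
Lemma sseq_chebU x k : sseq k (x ^+ 2 - 2%:R) = recz x 1 x (2 * k).
Proof.
have := recz_progression x 1 x 2 0 k.
rewrite !addr0 chebT2 recz0 mulrC => ->.
by rewrite /sseq; congr recz; rewrite /=; ring.
Qed.

(** Progression of step 2 from index 1: it starts with T_1(x) = x and T_3(x) = x ((x^2 - 2) - 1). *)
Lemma rseq_chebT x k : x * rseq k (x ^+ 2 - 2%:R) = recz x 2%:R x (2 * k + 1).
Proof.
rewrite mulrC (mulrC 2) recz_progression chebT2 recz1 mulrC mulr_recz.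
by congr recz; rewrite /=; ring.
Qed.

Lemma chebU_diff x k : recz x 1 x k - recz x 1 x (k - 2) = recz x 2%:R x k.
Proof.
apply: (recz_eq (f := fun k => recz x 1 x k - recz x 1 x (k - 2))) => [l||].
- have := reczSS x 1 x (l - 2).
  have -> : l - 2 + 2 = l by lia.
  have -> : l - 2 + 1 = l + 1 - 2 by lia.
  have -> : l + 2 - 2 = l by lia.
  by rewrite reczSS => E; rewrite {2}E; ring.
- by rewrite /=; ring.
- by rewrite /=; ring.
Qed.

(** Telescoping of [chebU_diff] in steps of 2. The bottom term is U_(e-1), that is U_(-1) = 0 or U_0
    = 1, hence [e] itself. *)
Lemma chebU_sum x (e : bool) (m : nat) :
  recz x 1 x ((2 * m + e)%N%:Z - 1) =
  e%:R + \sum_(1 <= i < m.+1) recz x 2%:R x ((2 * i + e)%N%:Z - 1).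
Proof.
elim: m => [|m IH].
  by rewrite big_geq // addr0 muln0 add0n; case: e; rewrite /=; ring.
rewrite big_nat_recr // addrA -IH -chebU_diff.
have -> : (2 * m.+1 + e)%N%:Z - 1 - 2 = (2 * m + e)%N%:Z - 1 by lia.
by rewrite addrC subrK.
Qed.

Lemma horner_recz (q a b : {poly A}) x k :
  (recz q a b k).[x] = recz q.[x] a.[x] b.[x] k.
Proof.
by apply: (recz_eq (f := fun k => (recz q a b k).[x])) => // l;
  rewrite reczSS !hornerE.
Qed.

Lemma horner_chebT x k : (chebT k).[x] = recz x 2%:R x k.
Proof. by rewrite horner_recz hornerX -polyC_natr hornerC. Qed.

Lemma horner_chebU x k : (chebU k).[x] = recz x 1 x k.
Proof. by rewrite horner_recz hornerX hornerC. Qed.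

End Recurrence.

(** * Ring morphisms and values at integers *)

Lemma rmorph_recz (A B : comNzRingType) (f : {rmorphism A -> B}) n a b k :
  f (recz n a b k) = recz (f n) (f a) (f b) k.
Proof.
by apply: (recz_eq (f := fun k => f (recz n a b k))) => // l;
  rewrite reczSS rmorphB rmorphM.
Qed.

Section IntCast.
Variable A : comNzRingType.
Implicit Types (j k : int).

Lemma intr_chebT j k : (chebT k).[j]%:~R = recz j%:~R 2%:R j%:~R k :> A.
Proof. by rewrite horner_chebT rmorph_recz. Qed.

Lemma intr_chebU j k : (chebU k).[j]%:~R = recz j%:~R 1 j%:~R k :> A.
Proof. by rewrite horner_chebU rmorph_recz. Qed.

Lemma intr_sseq j k : (sseq k j)%:~R = sseq k j%:~R :> A.
Proof. by rewrite /sseq rmorph_recz rmorphD. Qed.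

Lemma intr_rseq j k : (rseq k j)%:~R = rseq k j%:~R :> A.
Proof. by rewrite /rseq rmorph_recz rmorphB. Qed.

End IntCast.

(** * Polynomials in the shift operator and the sequences they kill *)

Section Annihilator.
Variable F : fieldType.
Implicit Types (P Q : {poly F}) (f g : int -> F).

Lemma iter_shift i f k : iter i (@shift F) f k = f (k + i%:Z).
Proof.
elim: i k => [|i IH] k; first by rewrite addr0.
by rewrite iterS /shift IH; congr f; lia.
Qed.

(** Coefficients past the size are 0, so polynomials of different sizes can be summed over a common
    range and compared termwise. *)
Lemma shift_poly_widen n P f k : (size P <= n)%N ->
  shift_poly P f k = \sum_(i < n) P`_i * f (k + i%:Z).
Proof.
move=> leP; rewrite /shift_poly
  (big_ord_widen _ (fun i => P`_i * iter i (@shift F) f k) leP).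
rewrite big_mkcond /=; apply: eq_bigr => i _.
by case: ltnP => [_|/(nth_default 0) ->]; rewrite ?mul0r // iter_shift.
Qed.

Lemma shift_polyDl P Q f k :
  shift_poly (P + Q) f k = shift_poly P f k + shift_poly Q f k.
Proof.
pose n := maxn (size P) (size Q).
rewrite !(@shift_poly_widen n) ?leq_maxl ?leq_maxr ?size_polyD //.
by rewrite -big_split; apply: eq_bigr => i _; rewrite coefD mulrDl.
Qed.

Lemma shift_polyZl c P f k : shift_poly (c *: P) f k = c * shift_poly P f k.
Proof.
rewrite !(@shift_poly_widen (size P)) ?size_scale_leq // mulr_sumr.
by apply: eq_bigr => i _; rewrite coefZ mulrA.
Qed.

Lemma shift_polyXl P f k : shift_poly ('X * P) f k = shift_poly P f (k + 1).
Proof.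
rewrite (@shift_poly_widen (size P).+1); last first.
  by rewrite (leq_trans (size_polyMleq _ _)) // size_polyX.
rewrite (@shift_poly_widen (size P)) // big_ord_recl coefXM mul0r add0r.
apply: eq_bigr => i _; rewrite coefXM; congr (_ * f _).
by rewrite /= /bump leq0n; lia.
Qed.

Lemma shift_poly1 f k : shift_poly 1 f k = f k.
Proof.
by rewrite (@shift_poly_widen 1) ?size_poly1 // big_ord1 coef1 mul1r addr0.
Qed.

Lemma shift_polyX f k : shift_poly 'X f k = f (k + 1).
Proof. by rewrite -['X]mulr1 shift_polyXl shift_poly1. Qed.

Lemma shift_polyXX f k : shift_poly 'X^2 f k = f (k + 2).
Proof. by rewrite expr2 shift_polyXl shift_polyX -addrA. Qed.

Lemma shift_poly_ext P f g k : f =1 g -> shift_poly P f k = shift_poly P g k.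
Proof.
move=> fg; rewrite !(@shift_poly_widen (size P)) //.
by apply: eq_bigr => i _; rewrite fg.
Qed.

Definition annihilates P f := forall k, shift_poly P f k = 0.

Lemma annihilates_ext P f g : f =1 g -> annihilates P f -> annihilates P g.
Proof. by move=> fg Pf k; rewrite -(shift_poly_ext _ _ fg). Qed.

Lemma annihilates_mull P Q f : annihilates P f -> annihilates (Q * P) f.
Proof.
move=> Pf; elim/poly_ind: Q => [|Q c IH] k.
  by rewrite mul0r -(scale0r P) shift_polyZl mul0r.
by rewrite mulrDl shift_polyDl mulrAC mulrC shift_polyXl IH mul_polyC
  shift_polyZl Pf mulr0 addr0.
Qed.

Lemma annihilates_add P f g :
  annihilates P f -> annihilates P g -> annihilates P (fun k => f k + g k).
Proof.
move=> Pf Pg k; rewrite -[RHS](addr0 0) -{1}(Pf k) -(Pg k).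
rewrite !(@shift_poly_widen (size P)) // -big_split.
by apply: eq_bigr => i _; rewrite mulrDr.
Qed.

Lemma annihilates_mulr P f c :
  annihilates P f -> annihilates P (fun k => f k * c).
Proof.
move=> Pf k; rewrite -(mul0r c) -(Pf k).
rewrite !(@shift_poly_widen (size P)) // mulr_suml.
by apply: eq_bigr => i _; rewrite mulrA.
Qed.

(** Each factor kills its own summand and the factors commute, so the product kills the whole
    sum. *)
Lemma annihilates_prod_sum (P : {poly F}) f (Q : nat -> {poly F})
    (g : nat -> int -> F) (m : nat) :
  annihilates P f -> (forall i, annihilates (Q i) (g i)) ->
  annihilates (P * \prod_(1 <= i < m.+1) Q i)
    (fun k => f k + \sum_(1 <= i < m.+1) g i k).
Proof.
move=> Pf Qg; elim: m => [|m IH].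
  rewrite big_geq // mulr1.
  by apply: annihilates_ext Pf => k; rewrite big_geq // addr0.
rewrite big_nat_recr //= mulrA.
apply: (@annihilates_ext _
  (fun k => (f k + \sum_(1 <= i < m.+1) g i k) + g m.+1 k)).
  by move=> k; rewrite /= -addrA -big_nat_recr.
apply: annihilates_add; last exact: annihilates_mull.
by rewrite mulrC; apply: annihilates_mull.
Qed.

Lemma annihilates_quadratic t f :
  (forall k, f (k + 2) = t * f (k + 1) - f k) ->
  annihilates ('X^2 - t *: 'X + 1) f.
Proof.
move=> Hf k; rewrite -scaleNr !shift_polyDl shift_polyZl.
by rewrite shift_polyXX shift_polyX shift_poly1 Hf; ring.
Qed.

(** For [e] false this is the polynomial 1 acting on the zero sequence, which lets both parities
    share one argument. *)
Lemma annihilates_const (e : bool) : annihilates (('X - 1) ^+ e) (fun=> e%:R).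
Proof.
move=> k; case: e; last by rewrite expr0 shift_poly1.
rewrite expr1 -scaleN1r shift_polyDl shift_polyZl shift_polyX shift_poly1.
by ring.
Qed.

End Annihilator.

(** * The characteristic polynomial, of degree 2m + e = p with [e] the parity of p *)

Definition charpoly (A : comNzRingType) (e : bool) (m : nat) (t : nat -> A)
    : {poly A} :=
  ('X - 1) ^+ e * \prod_(1 <= i < m.+1) ('X^2 - t i *: 'X + 1).

Lemma size_quadratic (A : comNzRingType) (t : A) :
  size ('X^2 - t *: 'X + 1 : {poly A}) = 3%N.
Proof.
rewrite -addrA size_polyDl size_polyXn //.
rewrite -scaleNr (leq_ltn_trans (size_polyD _ _)) // gtn_max size_poly1 andbT.
by rewrite (leq_ltn_trans (size_scale_leq _ _)) // size_polyX.
Qed.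

Lemma monic_quadratic (A : comNzRingType) (t : A) :
  'X^2 - t *: 'X + 1 \is @monic A.
Proof.
apply/monicP; rewrite lead_coefE size_quadratic.
by rewrite !coefD coefN coefZ coefXn coefX coef1 /=; ring.
Qed.

Lemma monic_charpoly (A : comNzRingType) e m (t : nat -> A) :
  charpoly e m t \is monic.
Proof.
rewrite monicMl ?monic_exp ?monicXsubC //.
  by apply: monic_prod => i _; exact: monic_quadratic.
Qed.

Lemma size_charpoly (A : idomainType) e m (t : nat -> A) :
  size (charpoly e m t) = (2 * m + e).+1.
Proof.
have H : \prod_(1 <= i < m.+1) ('X^2 - t i *: 'X + 1) \is @monic A.
  by apply: monic_prod => i _; exact: monic_quadratic.
rewrite /charpoly size_monicM ?monic_neq0 ?monic_exp ?monicXsubC //.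
rewrite size_exp_XsubC size_prod_seq => [|i _]; last first.
  exact/monic_neq0/monic_quadratic.
rewrite (eq_bigr (fun=> 3%N)) => [|i _]; last exact: size_quadratic.
by rewrite sum_nat_const_nat size_iota; lia.
Qed.

Lemma coef0_charpoly (A : comNzRingType) e m (t : nat -> A) :
  (charpoly e m t)`_0 = (-1) ^+ e.
Proof.
rewrite -horner_coef0 hornerM horner_exp horner_prod big1 => [|i _].
  by rewrite mulr1 !(hornerE, sub0r).
by rewrite !hornerE; ring.
Qed.

Lemma map_charpoly (A B : comNzRingType) (f : {rmorphism A -> B}) e m t :
  map_poly f (charpoly e m t) = charpoly e m (f \o t).
Proof.
rewrite rmorphM rmorphXn rmorphB rmorph1 rmorph_prod /= map_polyX.
congr (_ * _); apply: eq_bigr => i _.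
by rewrite rmorphD rmorphB /= map_polyXn map_polyZ map_polyX rmorph1.
Qed.

Lemma annihilates_chebU (F : fieldType) (x J : F) (e : bool) (m : nat) :
  x ^+ 2 = J + 2%:R ->
  annihilates (charpoly e m (fun i => recz J 2%:R J ((2 * i + e)%N%:Z - 1)))
    (fun k => recz (recz x 2%:R x (2 * k + 1)) 1 (recz x 2%:R x (2 * k + 1))
                ((2 * m + e)%N%:Z - 1)).
Proof.
move=> hx; pose a (i : nat) := (2 * i + e)%N%:Z - 1.
(* T_a(J) = T_a(T_2(x)) = T_(2a)(x), the parameter of a progression of step 2a. *)
have HJ i : recz J 2%:R J (a i) = recz x 2%:R x (a i * 2).
  by rewrite chebTM chebT2 hx addrK.
apply: (@annihilates_ext _ _ (fun k => e%:R +
    \sum_(1 <= i < m.+1) recz x 2%:R x (a i * (2 * k + 1)))).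
  move=> k; rewrite chebU_sum; congr (_ + _).
  by apply: eq_bigr => i _; rewrite chebTM.
apply: annihilates_prod_sum => [|i]; first exact: annihilates_const.
apply: annihilates_quadratic => k.
(* As a function of k, the index a(2k+1) runs with step 2a from offset a. *)
have E l : a i * (2 * l + 1) = l * (a i * 2) + a i by ring.
by rewrite !E recz_progressionSS HJ.
Qed.

(** * The quotient R_k *)

Section Main.
Variables (F : numFieldType) (p : nat) (j : int) (x : F).
Hypotheses (hx : x ^+ 2 = (j + 2)%:~R) (hU : (chebU (p%:Z - 1)).[x] != 0).

Let jE : j%:~R = x ^+ 2 - 2%:R :> F.
Proof. by rewrite hx intrD addrK. Qed.

Let chebTj k : recz x 2%:R x (k * 2) = (chebT k).[j]%:~R.
Proof. by rewrite chebTM chebT2 -jE intr_chebT. Qed.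

(** T_k(x) is to T_k(j) what x is to j: its square is T_k(j) + 2. Identities in x and x^2 - 2 can
    therefore be applied at T_k(x) as well. *)
Let sqr_chebT k : recz x 2%:R x k ^+ 2 - 2%:R = (chebT k).[j]%:~R.
Proof. by rewrite -chebT2 -chebTM mulrC chebTj. Qed.

Lemma RquotE k :
  Rquot p x k = recz (recz x 2%:R x (2 * k + 1)) 1
                  (recz x 2%:R x (2 * k + 1)) (p%:Z - 1)
                / (chebU (p%:Z - 1)).[x].
Proof. by rewrite /Rquot horner_chebU horner_chebT. Qed.

Lemma Rquot_sseq k :
  (sseq k (chebT p).[j])%:~R = Rquot p x k * (sseq k j)%:~R.
Proof.
rewrite RquotE !intr_sseq jE -sqr_chebT !sseq_chebU mulrAC.
apply: canRL (mulfK hU) _; rewrite horner_chebU.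
(* U_(p(2k+1)-1)(x) is factored in two ways, by steps 2k+1 and p. *)
have := chebU_predM x p (2 * k + 1).
rewrite [X in recz _ _ _ (X - 1) = _]mulrC chebU_predM addrK => E.
by rewrite mulrC E mulrC.
Qed.

Lemma Rquot2 k : p = 2%N -> Rquot p x k = (rseq k j)%:~R.
Proof.
move=> p2; move: hU; rewrite RquotE p2 horner_chebU => x0.
by rewrite !recz1 -rseq_chebT -jE -intr_rseq mulrAC mulfV ?mul1r.
Qed.

Lemma Rquot_odd m k : p = (2 * m).+1 ->
  Rquot p x k =
  (sseq m (chebT (2 * k + 1)).[j])%:~R / (sseq m j)%:~R.
Proof.
move=> pm; rewrite RquotE pm horner_chebU !intr_sseq jE -sqr_chebT !sseq_chebU.
by have -> : (2 * m).+1%:Z - 1 = 2 * m%:Z by lia.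
Qed.

(** This form gives rationality for even p, where x may be irrational: U_(2m-1)(y) = y U_(m-1)(y^2 -
    2) is taken at y = T_(2k+1)(x) and y = x, and the outer factors combine to T_(2k+1)(x) / x =
    r_k(j). *)
Lemma Rquot_even m k : p = (2 * m)%N ->
  Rquot p x k = (rseq k j)%:~R *
    ((chebU (m%:Z - 1)).[(chebT (2 * k + 1)).[j]]%:~R
     / (chebU (m%:Z - 1)).[j]%:~R).
Proof.
move=> pm; move: hU; rewrite RquotE pm.
have U2 y : recz y 1 y ((2 * m)%N%:Z - 1) =
    y * recz (y ^+ 2 - 2%:R) 1 (y ^+ 2 - 2%:R) (m%:Z - 1) :> F.
  have -> : (2 * m)%N%:Z = m%:Z * 2 by lia.
  by rewrite chebU_predM chebT2.
rewrite horner_chebU !U2 !intr_chebU sqr_chebT -jE mulf_eq0 negb_or.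
case/andP=> x0 u0; rewrite -rseq_chebT -jE intr_rseq; field.
by rewrite x0 u0.
Qed.

Lemma Rquot_recurrence (e : bool) m : p = (2 * m + e)%N ->
  annihilates
    (charpoly e m (fun i => (chebT ((2 * i + e)%N%:Z - 1)).[j]%:~R))
    (Rquot p x).
Proof.
move=> pE.
pose f k := recz (recz x 2%:R x (2 * k + 1)) 1 (recz x 2%:R x (2 * k + 1))
              (p%:Z - 1) * ((chebU (p%:Z - 1)).[x])^-1.
apply: (@annihilates_ext _ _ f) => [k|]; first by rewrite RquotE.
apply: annihilates_mulr; rewrite pE /charpoly.
under eq_bigr do rewrite intr_chebT.
by apply: annihilates_chebU; rewrite hx intrD.
Qed.

End Main.

Theorem theorem37 (R : realType) (p : nat) (j : int) (x : R[i])
    (hp : (2 <= p)%N) (hx : x ^+ 2 = (j + 2)%:~R)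
    (hU : (chebU (p%:Z - 1)).[x] != 0) :
  [/\ forall k : int,
        (sseq k (chebT p).[j])%:~R = Rquot p x k * (sseq k j)%:~R,
      forall k : int, exists q : rat, Rquot p x k = ratr q,
      rat_linear_recurrence p (Rquot p x),
      p = 2%N -> forall k : int, Rquot p x k = (rseq k j)%:~R
    & odd p ->
        (forall k : int,
           Rquot p x k =
             ratr ((sseq (p.-1)./2 (chebT (2 * k + 1)).[j])%:~R
                   / (sseq (p.-1)./2 j)%:~R))
        /\ (forall k : int,
           shift_poly
             (('X - 1) * \prod_(1 <= i < (p.-1)./2.+1)
                ('X^2 - ((chebT (2 * i)%N).[j])%:~R *: 'X + 1))
             (Rquot p x) k = 0)].
Proof.
have pE : p = (2 * p./2 + odd p)%N by lia.
have odd_half : odd p -> p = (2 * p.-1./2).+1 by lia.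
have Hodd : odd p -> forall k : int, Rquot p x k =
    ratr ((sseq p.-1./2 (chebT (2 * k + 1)).[j])%:~R / (sseq p.-1./2 j)%:~R).
  move=> /odd_half pm k.
  by rewrite (Rquot_odd hx hU k pm) fmorph_div /= !ratr_int.
split=> // [k|k||p2 k|op].
- exact: Rquot_sseq.
- have [/Hodd ->|/negbTE op] := boolP (odd p); first by eexists.
  have pm : p = (2 * p./2)%N by move: pE; rewrite op addn0.
  (* The right-hand side of [Rquot_even], computed in [rat]. *)
  exists ((rseq k j)%:~R *
    ((chebU (p./2%:Z - 1)).[(chebT (2 * k + 1)).[j]]%:~R
     / (chebU (p./2%:Z - 1)).[j]%:~R)).
  by rewrite (Rquot_even hx hU k pm) rmorphM fmorph_div /= !ratr_int.
(* The coefficients come from the integers T_a(j), so the polynomial is defined over [rat]; [ratr]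
   maps it to the one of [Rquot_recurrence]. Its constant term is 1 or -1. *)
- exists (charpoly (odd p) p./2
      (fun i => (chebT ((2 * i + odd p)%N%:Z - 1)).[j]%:~R)).
    rewrite monic_charpoly size_charpoly -pE coef0_charpoly.
    by rewrite expf_neq0 // oppr_eq0 oner_eq0.
  move=> k; rewrite map_charpoly -(Rquot_recurrence hx pE k).
  congr shift_poly; rewrite /charpoly; congr (_ * _); apply: eq_bigr => i _ /=.
  by rewrite ratr_int.
- exact: Rquot2.
split=> [|k]; first exact: Hodd.
rewrite -(Rquot_recurrence hx pE k) /charpoly op; congr shift_poly.
have -> : p.-1./2 = p./2 by lia.
rewrite expr1; congr (_ * _); apply: eq_bigr => i _.
(* For odd p the index 2i + e - 1 is 2i. *)
by have -> : (2 * i + true)%N%:Z - 1 = (2 * i)%N by lia.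
Qed.
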